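(* Let $A$ be a unital C$^*$-algebra, $X$ a vector space, $z\in A$ a fixed element, and let $V:A\times A\to X$ be a symmetric bilinear map that has the Jordan product property at $z$, i.e. for all $a,b,a',b'\in A$: $a\circ b=a'\circ b'=z\Rightarrow V(a,b)=V(a',b')$. Then: (i) for all $a,b\in A$, if $2a^2-2b^2=z$, then $2V(a,a)-2V(b,b)=V(1,z)$; (ii) for all $a,b\in A$, if $a^2=b^2=1$, then $V(a,a)=V(b,b)$; (iii) if $A$ is a Rickart C$^*$-algebra, then $V$ has the square-zero property, i.e. $a^2=0\Rightarrow V(a,a)=0$ for all $a\in A$.
   Context: All vector spaces, algebras and (bi)linear maps are over $\mathbb{C}$. For elements $a,b$ of an algebra, $a\circ b:=ab+ba$. A C$^*$-algebra $A$ is a Rickart C$^*$-algebra if for every $x\in A$ there exists a projection $p\in A$ such that the right annihilator $\{y\in A: xy=0\}$ equals $pA$. *)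

(* Defs.v *)
From HB Require Import structures.
From mathcomp Require Import all_boot all_order all_algebra.
From mathcomp Require Import complex.
From mathcomp Require Import boolp classical_sets functions reals.
From mathcomp Require Import topology normedtype.

Set Implicit Arguments.
Unset Strict Implicit.
Unset Printing Implicit Defensive.

Import GRing.Theory Num.Theory numFieldNormedType.Exports.

Local Open Scope ring_scope.

(* Unital C*-algebras over C = R[i].  The multiplication is part of the mixin,
   and the ring structure is derived from it below, because Hierarchy Builder
   cannot form the join of normed modules and rings once [numDomainType] has
   been declared.  The derived structure is a [pzRingType] and not an [algType]
   because the zero algebra is a unital C*-algebra.  The norm of a normed module
   over R[i] takes its values in the nonnegative reals of R[i]. *)
HB.mixin Record isCStarAlgebra (R : realType) A
    of CompleteNormedModule R[i] A := {
  cstar_one : A;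
  cstar_mul : A -> A -> A;
  cstar_mulA : associative cstar_mul;
  cstar_mul1x : left_id cstar_one cstar_mul;
  cstar_mulx1 : right_id cstar_one cstar_mul;
  cstar_mulDl : left_distributive cstar_mul +%R;
  cstar_mulDr : right_distributive cstar_mul +%R;
  cstar_scaleAl : forall (k : R[i]) (x y : A),
    k *: cstar_mul x y = cstar_mul (k *: x) y;
  cstar_scaleAr : forall (k : R[i]) (x y : A),
    k *: cstar_mul x y = cstar_mul x (k *: y);
  cstar_adj : A -> A;
  cstar_adjK : involutive cstar_adj;
  cstar_adjD : {morph cstar_adj : x y / x + y};
  cstar_adjZ : forall (k : R[i]) (x : A),
    cstar_adj (k *: x) = conjc k *: cstar_adj x;
  cstar_adjM : forall x y : A,
    cstar_adj (cstar_mul x y) = cstar_mul (cstar_adj y) (cstar_adj x);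
  cstar_normM : forall x y : A, `|cstar_mul x y| <= `|x| * `|y|;
  cstar_norm_adj : forall x : A, `|cstar_mul (cstar_adj x) x| = `|x| ^+ 2
}.

#[short(type="cstarAlgType")]
HB.structure Definition CStarAlgebra (R : realType) :=
  {A of isCStarAlgebra R A & CompleteNormedModule R[i] A}.

HB.instance Definition _ (R : realType) (A : cstarAlgType R) :=
  GRing.Zmodule_isPzRing.Build (CStarAlgebra.sort A)
    (@cstar_mulA R A) (@cstar_mul1x R A) (@cstar_mulx1 R A)
    (@cstar_mulDl R A) (@cstar_mulDr R A).

Section CStarDefs.
Variables (R : realType) (A : cstarAlgType R).

Definition is_projection (p : A) : Prop := cstar_adj p = p /\ p * p = p.

Definition is_rickart : Prop :=
  forall x : A, exists2 p : A, is_projection p &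
    ([set y | x * y = 0] = range (fun c : A => p * c))%classic.

Definition jordan (a b : A) : A := a * b + b * a.

Variable X : lmodType R[i].

Definition jordan_product_property_at (V : A -> A -> X) (z : A) : Prop :=
  forall a b a' b' : A, jordan a b = z -> jordan a' b' = z -> V a b = V a' b'.

Definition square_zero_property (V : A -> A -> X) : Prop :=
  forall a : A, a ^+ 2 = 0 -> V a a = 0.

End CStarDefs.

Arguments is_rickart {R} A.

(* Main.v *)
(** Since [(a + b) o (a - b) = 2 a^2 - 2 b^2] and [1 o (z / 2) = z], the
    Jordan product property gives (i).  If [a^2 = 1] and the scalar [r] is large, then
    [r^2 + z / 2] has a square root [c] that does not depend on [a]; applying
    (i) to [c] and [r a] expresses [V a a] in terms of [c], [r] and [z], which
    is (ii).  If [a^2 = 0] and the right annihilator of [a] is [p A], then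
    [p a = a] and [a p = 0], so that [u = 2 p - 1] and [u + a], [u - a] all
    square to [1]; adding the two equalities given by (ii) yields (iii). *)

Require Import Defs.
From HB Require Import structures.
From mathcomp Require Import all_boot all_order all_algebra.
From mathcomp Require Import complex reals lra.
From mathcomp Require Import boolp classical_sets topology normedtype.
Import Order.TTheory GRing.Theory Num.Theory.
Local Open Scope ring_scope.
Local Open Scope complex_scope.
Local Open Scope classical_set_scope.

Section SquareRoot.
Set Implicit Arguments.
Unset Strict Implicit.
Variables (R : realType) (A : cstarAlgType R).
Implicit Types x y w h : A.

Lemma cstar_scalerAl (k : R[i]) x y : k *: (x * y) = (k *: x) * y.
Proof. exact: cstar_scaleAl. Qed.

Lemma cstar_scalerAr (k : R[i]) x y : k *: (x * y) = x * (k *: y).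
Proof. exact: cstar_scaleAr. Qed.

Lemma cstar_exprZ2 (k : R[i]) x : (k *: x) ^+ 2 = k ^+ 2 *: x ^+ 2.
Proof. by rewrite !expr2 -cstar_scalerAl -cstar_scalerAr scalerA. Qed.

(* The norm of [A] has values in [R[i]], which is only partially ordered. *)
Definition real_norm x : R := complex.Re `|x|.

Lemma real_normE x : `|x| = (real_norm x)%:C.
Proof. by rewrite /real_norm RRe_real // normr_real. Qed.

Lemma real_norm_ge0 x : 0 <= real_norm x.
Proof. by rewrite -lecR -real_normE; exact: normr_ge0. Qed.

Lemma real_normD x y : real_norm (x + y) <= real_norm x + real_norm y.
Proof. by rewrite -lecR rmorphD /= -!real_normE ler_normD. Qed.

Lemma real_normN x : real_norm (- x) = real_norm x.
Proof. by rewrite /real_norm normrN. Qed.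

Lemma real_norm_distC x y : real_norm (x - y) = real_norm (y - x).
Proof. by rewrite -real_normN opprB. Qed.

Lemma real_normB x y : real_norm (x - y) <= real_norm x + real_norm y.
Proof. by rewrite -[in leRHS](real_normN y) real_normD. Qed.

Lemma real_normM x y : real_norm (x * y) <= real_norm x * real_norm y.
Proof. by rewrite -lecR rmorphM /= -!real_normE; exact: cstar_normM. Qed.

Lemma real_normZ (k : R) x : real_norm (k%:C *: x) = `|k| * real_norm x.
Proof.
apply: complexI; rewrite rmorphM /= -!real_normE normrZ; congr (_ * _).
by rewrite normc_def /= expr0n addr0 sqrtr_sqr.
Qed.

Lemma real_norm0_eq0 x : real_norm x = 0 -> x = 0.
Proof. by move=> x0; apply/normr0_eq0; rewrite real_normE x0. Qed.

(* A fixed point [h] of this map is a solution of [(1 + h)^2 = 1 + w]; for small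
   [w] the map contracts the ball of radius 1/4. *)
Definition sqrt_step w h : A := (2^-1 : R)%:C *: (w - h * h).

Lemma real_norm_half x : real_norm ((2^-1 : R)%:C *: x) = real_norm x / 2.
Proof. by rewrite real_normZ ger0_norm ?invr_ge0 // mulrC. Qed.

(** As [h] and [k] need not commute, the difference of squares is split as
    [k * (k - h) + (k - h) * h]. *)
Lemma sqrt_stepB w h k : real_norm (sqrt_step w h - sqrt_step w k) <=
  (real_norm h + real_norm k) / 2 * real_norm (h - k).
Proof.
have -> : sqrt_step w h - sqrt_step w k =
    (2^-1 : R)%:C *: (k * (k - h) + (k - h) * h).
  rewrite -scalerBr; congr (_ *: _).
  by rewrite mulrBr mulrBl addrA subrK opprB addrCA addrAC subrr add0r.
rewrite real_norm_half (real_norm_distC h) mulrAC ler_pM2r ?invr_gt0 //.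
apply: le_trans (real_normD _ _) _.
rewrite [leRHS]mulrDl addrC lerD // ?real_normM //.
by rewrite (le_trans (real_normM _ _)) // mulrC.
Qed.

Lemma sqrt_step_fixed w h : h = sqrt_step w h -> (1 + h) ^+ 2 = 1 + w.
Proof.
move=> hE; rewrite expr2 mulrDl mul1r mulrDr mulr1 -addrA; congr (_ + _).
have : (2%:R : R[i]) *: h = w - h * h.
  rewrite {1}hE scalerA -(rmorph_nat (real_complex R)) -rmorphM /=.
  by rewrite mulfV ?scale1r // pnatr_eq0.
by rewrite scaler_nat mulr2n addrA => ->; rewrite subrK.
Qed.

Section Iteration.
Variables (w : A) (w_small : real_norm w <= 1 / 4).
Let y n := iter n (sqrt_step w) 0.

(** The ball of radius 1/4 is stable because (1/4 + 1/16) / 2 < 1/4. *)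
Lemma sqrt_iter_le n : real_norm (y n) <= 1 / 4.
Proof.
elim: n => [|n IH]; first by rewrite /= /real_norm normr0 /=; lra.
rewrite -[y n.+1]/(sqrt_step w (y n)) real_norm_half.
have := real_normB w (y n * y n); have := real_normM (y n) (y n).
have := ler_pM (real_norm_ge0 (y n)) (real_norm_ge0 (y n)) IH IH.
move: w_small; lra.
Qed.

(** On that ball [sqrt_stepB] gives the contraction factor 1/4; the cruder 1/2 suffices here. *)
Lemma sqrt_iter_dist n m : real_norm (y n - y (n + m)) <= (2^-1) ^+ n.
Proof.
elim: n m => [|n IH] m.
  rewrite add0n /= expr0; have := sqrt_iter_le m.
  by rewrite sub0r real_normN; lra.
rewrite addSn exprS; apply: le_trans (sqrt_stepB w (y n) (y (n + m))) _.
have := sqrt_iter_le n; have := sqrt_iter_le (n + m).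
have := real_norm_ge0 (y n); have := real_norm_ge0 (y (n + m)).
have := real_norm_ge0 (y n - y (n + m)); have := IH m.
set a := real_norm (y n); set b := real_norm (y (n + m)).
by move=> *; apply: ler_pM => //; lra.
Qed.

Lemma sqrt_iter_cvg : exists l, forall e : R, 0 < e ->
  exists2 n, real_norm (l - y n) < e & real_norm (l - y n.+1) < e.
Proof.
have : cauchy (y @ \oo).
  apply: cauchy_exP => e e0.
  have eE : e = (complex.Re e)%:C by rewrite RRe_real // gtr0_real.
  have re0 : 0 < complex.Re e by rewrite -ltcR -eE.
  (* Since 2^n > n, any [N] above 1/e satisfies 2^-N < e. *)
  pose N := Num.bound (complex.Re e)^-1.
  exists (y N); exists N => // n Nn.
  rewrite -ball_normE; change (is_true (`|y N - y n| < e)).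
  rewrite real_normE eE ltcR -(subnKC Nn).
  apply: le_lt_trans (sqrt_iter_dist _ _) _.
  rewrite exprVn invf_plt ?posrE ?exprn_gt0 //.
  apply: lt_trans (archi_boundP _) _; first by rewrite invr_ge0 ltW.
  by rewrite -natrX ltr_nat ltn_expl.
move=> /cauchy_cvgP /cvg_ex [l /cvgrPdist_lt yl]; exists l => e e0.
have [|N _ NP] := yl e%:C; first by rewrite ltcR.
by exists N; rewrite -ltcR -real_normE; apply: NP => /=.
Qed.

(** The limit [l] of the iterates is a fixed point: the norm of [l - sqrt_step w l] is bounded
    through [y n.+1] by every positive [e]. *)
Lemma sqrt1D : exists h, (1 + h) ^+ 2 = 1 + w.
Proof.
have [l yl] := sqrt_iter_cvg; exists l.
apply: sqrt_step_fixed; apply/eqP; rewrite -subr_eq0; apply/eqP/real_norm0_eq0.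
apply/eqP; rewrite eq_le real_norm_ge0 andbT; apply/ler_addgt0Pr => e e0.
(* The bound 1 gives [l] norm at most 5/4, so the factor in [sqrt_stepB] is at most 3/4, and e/3 +
   (3/4)(e/3) < e. *)
have [|n] := yl (Num.min 1 (e / 3)).
  by rewrite lt_min ltr01 divr_gt0.
rewrite !lt_min => /andP[d1 de] /andP[_ de'].
have -> : l - sqrt_step w l =
    (l - y n.+1) + (sqrt_step w (y n) - sqrt_step w l).
  by rewrite addrA subrK.
have := real_normD (l - y n.+1) (sqrt_step w (y n) - sqrt_step w l).
have := sqrt_stepB w (y n) l; rewrite (real_norm_distC (y n) l).
have : real_norm l <= real_norm (l - y n) + real_norm (y n).
  by rewrite -[X in real_norm X <= _](subrK (y n)) real_normD.
have := sqrt_iter_le n; have := real_norm_ge0 (l - y n).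
have := real_norm_ge0 (y n); have := real_norm_ge0 l.
set a := real_norm (y n); set b := real_norm l; set d := real_norm (l - y n).
move=> *; nra.
Qed.

End Iteration.
End SquareRoot.

Lemma jordan_sum_diff (R : realType) (A : cstarAlgType R) (a b : A) :
  jordan (a + b) (a - b) = 2 *: a ^+ 2 - 2 *: b ^+ 2.
Proof.
rewrite /jordan !scaler_nat !expr2 !mulr2n !mulrDl !mulNr !mulrBr !mulrDr !opprD.
move: (a * a) (a * b) (b * a) (b * b) => x y t u.
rewrite [t - u]addrC [- t - u]addrC [x - y + _]addrACA [x + y + _]addrACA.
by rewrite [LHS]addrACA [- y + t + _]addrACA addNr subrr !addr0 addrACA.
Qed.

Theorem lemma3p2 (R : realType) (A : cstarAlgType R) (X : lmodType R[i])
    (z : A) (V : {bilinear A -> A -> X})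
    (V_sym : forall a b : A, V a b = V b a)
    (V_jordan : jordan_product_property_at V z) :
  [/\ (forall a b : A, 2 *: a ^+ 2 - 2 *: b ^+ 2 = z ->
         2 *: V a a - 2 *: V b b = V 1 z),
      (forall a b : A, a ^+ 2 = 1 -> b ^+ 2 = 1 -> V a a = V b b)
    & (is_rickart A -> square_zero_property V)].
Proof.
have two0 : (2 : R[i]) != 0 by rewrite pnatr_eq0.
have P1 (a b : A) : 2 *: a ^+ 2 - 2 *: b ^+ 2 = z ->
    2 *: V a a - 2 *: V b b = V 1 z.
  rewrite -jordan_sum_diff => abz.
  have half : jordan 1 (2^-1 *: z) = z.
    by rewrite /jordan mul1r mulr1 -mulr2n -scaler_nat scalerA mulfV ?scale1r.
  have := V_jordan _ _ _ _ abz half.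
  rewrite linearZr_LR linearBr !linearDl (V_sym b a) opprD addrA addrK => E.
  by rewrite -scalerBr E scalerA mulfV ?scale1r.
have P2 (a b : A) : a ^+ 2 = 1 -> b ^+ 2 = 1 -> V a a = V b b.
  (* With n the norm of [z], (1 + n)^2 >= 2n, so z / (2 r^2) has norm at most 1/4 and [sqrt1D]
     applies. *)
  pose r := 1 + real_norm z.
  have r1 : 1 <= r by rewrite lerDl real_norm_ge0.
  have r0 : r%:C != 0 by rewrite (inj_eq (@complexI R)) gt_eqF //; lra.
  have zr : real_norm (((2 * r ^+ 2)^-1)%:C *: z) <= 1 / 4.
    rewrite real_normZ ger0_norm; last by rewrite invr_ge0 mulr_ge0 ?sqr_ge0.
    rewrite mulrC ler_pdivrMr; last by rewrite mulr_gt0 // exprn_gt0 //; lra.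
    rewrite expr2 /r; have := real_norm_ge0 z; nra.
  have [h hE] := sqrt1D zr.
  (* Here (r (1 + h))^2 = r^2 + z/2 while (r c)^2 = r^2, so (i) applies; only the term in [V c c]
     depends on [c]. *)
  have V_of_sqrt1 (c : A) : c ^+ 2 = 1 ->
      2 *: V (r%:C *: (1 + h)) (r%:C *: (1 + h))
        - (2 * r%:C ^+ 2) *: V c c = V 1 z.
    move=> c1; rewrite -(P1 (r%:C *: (1 + h)) (r%:C *: c)).
      by congr (_ - _); rewrite linearZl_LR linearZr_LR !scalerA expr2 mulrA.
    rewrite !cstar_exprZ2 hE c1 -scalerBr -scalerBr addrAC subrr add0r !scalerA.
    rewrite -(rmorph_nat (real_complex R)) -rmorphXn -!rmorphM /=.
    by rewrite mulfV ?scale1r // gt_eqF // mulr_gt0 // exprn_gt0 //; lra.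
  move=> /V_of_sqrt1 aE /V_of_sqrt1; rewrite -aE => /addrI /oppr_inj.
  by move/(scalerI _) => ->//; rewrite mulf_neq0 ?expf_neq0.
split=> // rick a; rewrite expr2 => a0.
have [p [_ pp] annE] := rick a.
(* [a] annihilates itself, hence lies in pA and is fixed by [p] on the left; conversely p = pp lies
   in pA, hence is annihilated by [a]. *)
have [c _ aE] : range (fun c => p * c) a by rewrite -annE.
have pa : p * a = a by rewrite -aE mulrA pp.
have ap : a * p = 0.
  have : range (fun c => p * c) p by exists p.
  by rewrite -annE.
pose u : A := p + p - 1.
have u1 : u ^+ 2 = 1.
  rewrite expr2 /u mulrBr mulr1 mulrBl mul1r mulrDl mulrDr pp.
  by rewrite addrK opprB addrC subrK.
have ua : u * a = a by rewrite /u mulrBl mul1r mulrDl pa addrK.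
have au : a * u = - a by rewrite /u mulrBr mulr1 mulrDr ap addr0 sub0r.
clearbody u.
have ua1 : (u + a) ^+ 2 = 1.
  by rewrite expr2 mulrDl !mulrDr ua au a0 -expr2 u1 addr0 addrK.
have ua2 : (u - a) ^+ 2 = 1.
  by rewrite expr2 mulrBl !mulrBr ua au a0 -expr2 u1 subr0 opprK subrK.
(* The two signs of [a] give opposite cross terms, which cancel in the sum and leave
   [2 *: V a a = 0]. *)
have E1 : V a a + (V u a + V u a) = 0.
  apply: (@addrI _ (V u u)); rewrite addr0 -[RHS](P2 _ _ ua1 u1).
  by rewrite linearDr !linearDl (V_sym a u) addrCA addrC !addrA.
have E2 : V a a - (V u a + V u a) = 0.
  apply: (@addrI _ (V u u)); rewrite addr0 -[RHS](P2 _ _ ua2 u1).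
  by rewrite linearBr !linearBl (V_sym a u) !opprD opprK addrCA addrC !addrA.
apply: (scalerI two0); rewrite scaler0 scaler_nat mulr2n.
by rewrite -[RHS]addr0 -{1}E1 -E2 addrACA subrr addr0.
Qed.
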